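(* Let $\{w^k\}_{k\ge 0}$, $w^k=(y^k,z^k,x^k)\in\mathbb H$, be a sequence generated from an initial point $w^0\in\mathbb H$ by the majorized ADMM iteration described in the context. Then for every $k\ge 0$ it satisfies the perturbed degenerate proximal point inclusion $$0\in \mathcal R(w^{k+1})+\mathcal M(w^{k+1}-w^k)+\mathcal E^k,\qquad \mathcal E^k:=\mathcal F_{sm}(w^k)-\mathcal F_{sm}(w^{k+1}),$$ or, equivalently, $$0\in \mathcal R_{ns}(w^{k+1})+\mathcal F_{sm}(w^k)+\mathcal M(w^{k+1}-w^k).$$ Moreover, if $\mathcal S+\widehat\Sigma_f\succeq 0$ and $\mathcal T+\widehat\Sigma_g\succeq 0$, then $\mathcal M\succeq 0$.
   Context: **Setting.** $\mathbb X,\mathbb Y,\mathbb Z$ are finite-dimensional Euclidean spaces, each with an inner product $\langle\cdot,\cdot\rangle$ and induced norm $\|\cdot\|$; $\mathbb H:=\mathbb Y\times\mathbb Z\times\mathbb X$ carries the product inner product, with elements $w=(y,z,x)$. $p:\mathbb Y\to(-\infty,+\infty]$ and $q:\mathbb Z\to(-\infty,+\infty]$ are closed proper convex; $f:\mathbb Y\to\mathbb R$ and $g:\mathbb Z\to\mathbb R$ are convex and differentiable with Lipschitz continuous gradients; $A:\mathbb Y\to\mathbb X$, $B:\mathbb Z\to\mathbb X$ are linear with adjoints $A^*,B^*$; $c\in\mathbb X$. The problem is $\min_{y,z}\ p(y)+f(y)+q(z)+g(z)$ subject to $Ay+Bz=c$. For a self-adjoint linear operator $\Sigma$ (possibly indefinite),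 $\|v\|_\Sigma^2:=\langle v,\Sigma v\rangle$; $\Sigma\succeq0$ means positive semidefinite. **Majorization.** $\widehat\Sigma_f$ on $\mathbb Y$ and $\widehat\Sigma_g$ on $\mathbb Z$ are self-adjoint positive semidefinite linear operators such that, with $$\hat f(y,y'):=f(y')+\langle\nabla f(y'),y-y'\rangle+\tfrac12\|y-y'\|_{\widehat\Sigma_f}^2,\quad \hat g(z,z'):=g(z')+\langle\nabla g(z'),z-z'\rangle+\tfrac12\|z-z'\|_{\widehat\Sigma_g}^2,$$ one has $f(y)\le\hat f(y,y')$ and $g(z)\le\hat g(z,z')$ for all $y,y'\in\mathbb Y$, $z,z'\in\mathbb Z$. Let $\sigma>0$, and let $\mathcal S$ on $\mathbb Y$ and $\mathcal T$ on $\mathbb Z$ be self-adjoint linear operators (not necessarily semidefinite). **Majorized ADMM iteration.** Given $w^k=(y^k,z^k,x^k)$, the next iterate is obtained by: $z^{k+1}$ is a minimizer over $z\in\mathbb Z$ of $$q(z)+\hat g(z,z^k)+\langle B^*x^k,z\rangle+\tfrac\sigma2\|Ay^k+Bz-c\|^2+\tfrac12\|z-z^k\|_{\mathcal T}^2;$$ then $x^{k+1}=x^k+\sigma(Ay^k+Bz^{k+1}-c)$; then $y^{k+1}$ is a minimizer over $y\in\mathbb Y$ of $$p(y)+\hat f(y,y^k)+\langle A^*x^{k+1},y\rangle+\tfrac\sigma2\|Ay+Bz^{k+1}-c\|^2+\tfrac12\|y-y^k\|_{\mathcal S}^2.$$ **Operators on $\mathbb H$.** With $\partial$ the convex subdifferential,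 $$\mathcal R_{ns}(w)=\begin{pmatrix}\partial p(y)+A^*x\\ \partial q(z)+B^*x\\ -Ay-Bz+c\end{pmatrix},\quad \mathcal F_{sm}(w)=\begin{pmatrix}\nabla f(y)\\ \nabla g(z)\\ 0\end{pmatrix},\quad \mathcal R=\mathcal R_{ns}+\mathcal F_{sm},$$ $$\mathcal M=\begin{pmatrix}\mathcal S+\widehat\Sigma_f+\sigma A^*A&0&A^*\\ 0&\mathcal T+\widehat\Sigma_g&0\\ A&0&\sigma^{-1}I\end{pmatrix}.$$ *)

(* Defs.v *)
From HB Require Import structures.
From mathcomp Require Import all_boot all_order all_algebra.
From mathcomp Require Import all_classical all_reals all_analysis.

Set Implicit Arguments.
Unset Strict Implicit.
Unset Printing Implicit Defensive.

Import Order.TTheory GRing.Theory Num.Theory.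
Import numFieldNormedType.Exports.

Local Open Scope classical_set_scope.
Local Open Scope ring_scope.

(* Symmetry and positive definiteness are part of [{dot E for idfun}]; finite
   dimension is the [Vector] structure. *)
HB.mixin Record isEuclidean (R : realType) E
    & NormedModule R E & Vector R E := {
  inner : {dot E for @idfun R} ;
  inner_norm : forall u : E, inner u u = `|u| ^+ 2
}.

#[short(type="euclideanType")]
HB.structure Definition Euclidean (R : realType) :=
  {E of NormedModule R E & Vector R E & isEuclidean R E}.

Notation "''[' u , v ]" := (inner u v) : ring_scope.

Section inner_theory.
Context {R : realType} {E : euclideanType R}.
Implicit Types (u v w : E) (a : R).

Lemma innerC u v : '[u, v] = '[v, u].
Proof. by rewrite hermitian_subproof/= expr0 mul1r. Qed.

Lemma innerDr u v w : '[w, u + v] = '[w, u] + '[w, v].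
Proof. exact: raddfD. Qed.

Lemma innerZr a u w : '[w, a *: u] = a * '[w, u].
Proof. exact: linearZ. Qed.

Lemma innerDl u v w : '[u + v, w] = '[u, w] + '[v, w].
Proof. by rewrite innerC innerDr !(innerC w). Qed.

Lemma innerZl a u w : '[a *: u, w] = a * '[u, w].
Proof. by rewrite innerC innerZr (innerC w). Qed.

Lemma inner_eq0 u : '[u, u] = 0 -> u = 0.
Proof. by rewrite inner_norm => /eqP; rewrite sqrf_eq0 normr_eq0 => /eqP. Qed.

Lemma inner_inj u v : (forall w, '[u, w] = '[v, w]) -> u = v.
Proof.
move=> uv; apply/subr0_eq/inner_eq0.
by rewrite -[in X in '[X, _]]scaleN1r innerDl innerZl uv mulN1r subrr.
Qed.

Lemma riesz_ex (phi : {linear E -> R}) : exists v, forall u, phi u = '[v, u].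
Proof.
pose F v : 'Hom(E, R^o) := linfun (inner v : E -> R^o).
have FE v u : F v u = '[v, u] by rewrite lfunE.
have linF : linear F.
  move=> a u v; apply/lfunP => x.
  by rewrite add_lfunE scale_lfunE !FE innerDl innerZl.
pose F' := GRing.isLinear.Build _ _ _ _ F linF.
pose FL : {linear E -> 'Hom(E, R^o)} := HB.pack F F'.
have kF : lker (linfun FL) == 0%VS.
  apply/lker0P => u v; rewrite !lfunE/= => /lfunP uv.
  by apply: inner_inj => w; rewrite -!FE.
have : linfun (phi : E -> R^o) \in limg (linfun FL).
  suff -> : limg (linfun FL) = fullv by exact: memvf.
  apply/eqP; rewrite eqEdim subvf/= limg_dim_eq ?(eqP kF) ?capv0//.
  by rewrite !dimvf/= /dim/= muln1.
case/memv_imgP => v _ phiv; exists v => u.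
by rewrite -FE -[phi u](lfunE (phi : {linear E -> R^o}))/= phiv lfunE.
Qed.

Definition riesz (phi : {linear E -> R}) : E := projT1 (cid (riesz_ex phi)).

Lemma rieszE (phi : {linear E -> R}) u : phi u = '[riesz phi, u].
Proof. exact: projT2 (cid (riesz_ex phi)) u. Qed.

End inner_theory.

Section adjoint.
Context {R : realType} {U V : euclideanType R}.
Variable A : {linear U -> V}.

Definition inner_comp (v : V) (u : U) : R := '[v, A u].

Lemma inner_comp_linear v : linear_for *%R (inner_comp v).
Proof.
by move=> a x y; rewrite /inner_comp linearP innerDr innerZr.
Qed.

HB.instance Definition _ v :=
  GRing.isLinear.Build R U R *%R (inner_comp v) (inner_comp_linear v).

Definition adj (v : V) : U := riesz (inner_comp v).

Lemma adjE v u : '[adj v, u] = '[v, A u].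
Proof. by rewrite -rieszE. Qed.

Lemma adj_linear : linear adj.
Proof.
move=> a x y; apply: inner_inj => u.
by rewrite innerDl innerZl !adjE innerDl innerZl.
Qed.

HB.instance Definition _ := GRing.isLinear.Build R V U *:%R adj adj_linear.

End adjoint.

Definition grad {R : realType} {E : euclideanType R} (f : E -> R) (u : E) : E :=
  riesz ('d f u).

Section linear_operators.
Context {R : realType} {V : lmodType R} (form : {dot V for @idfun R}).
Implicit Type L : {linear V -> V}.

Definition self_adjoint L := forall u v, form (L u) v = form u (L v).

Definition psd L := self_adjoint L /\ forall v, 0 <= form v (L v).

End linear_operators.

Section convex_analysis.
Context {R : realType} {E : euclideanType R}.
Implicit Type p : E -> \bar R.
Local Open Scope ereal_scope.

Definition eproper p :=
  (forall u, p u != -oo) /\ exists u, p u < +oo.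

(* At [t = 0] or [t = 1] this relies on [0 * +oo = 0]; the right-hand side is
   never [+oo - oo] for a proper [p]. *)
Definition econvex p := forall (t : R) u v, (0 <= t <= 1)%R ->
  p (t *: u + (1 - t) *: v)%R <= t%:E * p u + (1 - t)%:E * p v.

Definition closed_proper_convex p :=
  [/\ lower_semicontinuous p, eproper p & econvex p].

Definition subdifferential p (u : E) : set E :=
  [set s | forall v, p u + ('[s, v - u])%:E <= p v].

Definition minimizer p (u : E) := forall v, p u <= p v.

End convex_analysis.

Section majorant.
Context {R : realType} {E : euclideanType R}.
Implicit Type L : {linear E -> E}.

(* [||v||_L^2]; it may be negative. *)
Definition sqnorm L (v : E) : R := '[v, L v].

Definition majorant (f : E -> R) L (u u' : E) : R :=
  f u' + '[grad f u', u - u'] + 2^-1 * sqnorm L (u - u').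

Definition majorized (f : E -> R) L := forall u u', f u <= majorant f L u u'.

Definition convex_smooth (f : E -> R) :=
  [/\ convex_function [set: convex_lmodType E] f,
      forall u, differentiable f u & lipschitz (grad f)].

End majorant.

Section product.
Context {R : realType} (Y Z X : euclideanType R).

(* The library norm on a product is the max norm, so only the inner product is
   put on [prodH]. A point is [(y, z, x)]. *)
Definition prodH : Type := (Y * Z * X)%type.

HB.instance Definition _ := GRing.Lmodule.on prodH.

Definition innerH (w w' : prodH) : R :=
  '[w.1.1, w'.1.1] + '[w.1.2, w'.1.2] + '[w.2, w'.2].

Lemma innerHC w w' : innerH w w' = innerH w' w.
Proof. by rewrite /innerH innerC (innerC w.1.2) (innerC w.2). Qed.

Lemma innerH_linear w : linear_for *%R (innerH w).
Proof.
move=> a u v; rewrite /innerH/= !innerDr !innerZr !mulrDr.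
by rewrite [RHS]addrACA; congr (_ + _); rewrite addrACA.
Qed.

Lemma innerH_bilinear : bilinear_for *%R (idfun \; *%R) innerH.
Proof.
split=> w a u v; last exact: innerH_linear.
by rewrite !(innerHC _ w) innerH_linear.
Qed.

HB.instance Definition _ :=
  bilinear_isBilinear.Build R prodH prodH R *%R (idfun \; *%R) innerH
    innerH_bilinear.

Lemma innerH_hermitian w w' : innerH w w' = (-1) ^+ false * idfun (innerH w' w).
Proof. by rewrite expr0 mul1r innerHC. Qed.

HB.instance Definition _ :=
  isHermitianSesquilinear.Build R prodH false idfun innerH innerH_hermitian.

Lemma innerH_gt0 w : w != 0 -> 0 < innerH w w.
Proof.
rewrite lt_neqAle /innerH !inner_norm !addr_ge0 ?sqr_ge0// andbT.
apply: contra; rewrite [0 == _]eq_sym !paddr_eq0 ?addr_ge0 ?sqr_ge0// !sqrf_eq0 !normr_eq0.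
by case: w => -[y z] x /= /andP[/andP[/eqP-> /eqP->] /eqP->].
Qed.

HB.instance Definition _ := isDotProduct.Build R prodH innerH innerH_gt0.

End product.

Section admm.
Context {R : realType} {Y Z X : euclideanType R}.
Variables (p : Y -> \bar R) (q : Z -> \bar R) (f : Y -> R) (g : Z -> R).
Variables (A : {linear Y -> X}) (B : {linear Z -> X}) (c : X).
Variables (Sf S : {linear Y -> Y}) (Sg T : {linear Z -> Z}) (sigma : R).
Implicit Types w : prodH Y Z X.

Definition z_objective w (z : Z) : \bar R :=
  (q z + (majorant g Sg z w.1.2 + '[adj B w.2, z]
          + sigma / 2 * `|A w.1.1 + B z - c| ^+ 2
          + 2^-1 * sqnorm T (z - w.1.2))%:E)%E.

Definition y_objective (y0 : Y) (z : Z) (x : X) (y : Y) : \bar R :=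
  (p y + (majorant f Sf y y0 + '[adj A x, y]
          + sigma / 2 * `|A y + B z - c| ^+ 2
          + 2^-1 * sqnorm S (y - y0))%:E)%E.

Definition admm_step w w' :=
  [/\ minimizer (z_objective w) w'.1.2,
      w'.2 = w.2 + sigma *: (A w.1.1 + B w'.1.2 - c) &
      minimizer (y_objective w.1.1 w'.1.2 w'.2) w'.1.1].

Definition opRns w : set (prodH Y Z X) :=
  [set (s + adj A w.2, t + adj B w.2, - A w.1.1 - B w.1.2 + c)
    | s in subdifferential p w.1.1 & t in subdifferential q w.1.2].

Definition opFsm w : prodH Y Z X := (grad f w.1.1, grad g w.1.2, 0).

Definition opR w : set (prodH Y Z X) := [set u + opFsm w | u in opRns w].

Definition opM w : prodH Y Z X :=
  (S w.1.1 + Sf w.1.1 + sigma *: adj A (A w.1.1) + adj A w.2,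
   T w.1.2 + Sg w.1.2,
   A w.1.1 + sigma^-1 *: w.2).

Lemma opM_linear : linear opM.
Proof.
have scaleDD (V : lmodType R) (a : R) (x y x' y' : V) :
    a *: x + y + (a *: x' + y') = a *: (x + x') + (y + y').
  by rewrite scalerDr addrACA.
by move=> a u v; rewrite /opM/= !linearP/= !scaleDD.
Qed.

HB.instance Definition _ :=
  GRing.isLinear.Build R (prodH Y Z X) (prodH Y Z X) *:%R opM opM_linear.

Definition perturbation w w' : prodH Y Z X := opFsm w - opFsm w'.

Definition perturbed_ppa w w' :=
  [set u + opM (w' - w) + perturbation w w' | u in opR w'] 0.

Definition perturbed_ppa_ns w w' :=
  [set u + opFsm w + opM (w' - w) | u in opRns w'] 0.

End admm.

(* Main.v *)
Require Import Defs.
From HB Require Import structures.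
From mathcomp Require Import all_boot all_order all_algebra.
From mathcomp Require Import all_classical all_reals all_analysis.
From mathcomp Require Import ring lra.
Import Order.TTheory GRing.Theory Num.Theory.
Import numFieldNormedType.Exports.
Local Open Scope classical_set_scope.
Local Open Scope ring_scope.

(** Each ADMM subproblem minimises [p + h] with [p] proper convex and [h]
    quadratic. Comparing the minimiser [u] with [u + t (v - u)], dividing by [t]
    and letting [t] tend to [0] gives [- grad h u \in subdifferential p u]. These
    two optimality conditions together with the multiplier update are the three
    components of the inclusion. Positivity of [opM] comes from completing the
    square in the [(y, x)] block:
    [sigma |A y|^2 + 2 <A y, x> + sigma^-1 |x|^2 = sigma |A y + sigma^-1 x|^2]. *)

(** [G] plays the role of the gradient of [h] at [u]. The expansion is exact along every ray, with
    [K] a bare function of the direction, so first-order conditions need no differential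
    calculus. *)
Definition quadratic_at {R : realType} {E : euclideanType R} (h : E -> R)
    (u G : E) :=
  exists K : E -> R, forall (t : R) d,
    h (u + t *: d) = h u + t * '[G, d] + t ^+ 2 * K d.

Section quadratic_at.
Context {R : realType} {E : euclideanType R}.
Implicit Types (h : E -> R) (u v G : E).

Lemma innerNl u v : '[- u, v] = - '[u, v].
Proof. by rewrite -scaleN1r innerZl mulN1r. Qed.

Lemma inner0l v : '[0, v] = 0.
Proof. by rewrite -(scale0r v) innerZl mul0r. Qed.

Lemma quadratic_at_cst (a : R) u : quadratic_at (fun=> a) u 0.
Proof.
exists (fun=> 0) => t d.
by rewrite inner0l !mulr0 !addr0.
Qed.

Lemma quadratic_atD h h' u G G' :
  quadratic_at h u G -> quadratic_at h' u G' ->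
  quadratic_at (fun v => h v + h' v) u (G + G').
Proof.
move=> [K hK] [K' hK']; exists (fun d => K d + K' d) => t d.
rewrite hK hK' innerDl; ring.
Qed.

Lemma quadratic_atZ (a : R) h u G :
  quadratic_at h u G -> quadratic_at (fun v => a * h v) u (a *: G).
Proof.
move=> [K hK]; exists (fun d => a * K d) => t d.
rewrite hK innerZl; ring.
Qed.

Lemma quadratic_at_shift h u0 u G :
  quadratic_at h (u - u0) G ->
  quadratic_at (fun v => h (v - u0)) u G.
Proof. by move=> [K hK]; exists K => t d; rewrite addrAC hK. Qed.

Lemma quadratic_at_inner G u : quadratic_at (inner G) u G.
Proof.
by exists (fun=> 0) => t d; rewrite innerDr innerZr mulr0 addr0.
Qed.

(** Self-adjointness merges the cross terms ['[u, L d]] and ['[d, L u]] into [2 * '[L u, d]]. *)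
Lemma quadratic_at_sqnorm (L : {linear E -> E}) u :
  self_adjoint inner L -> quadratic_at (sqnorm L) u (2 *: L u).
Proof.
move=> sL; exists (sqnorm L) => t d.
have LE : L (u + t *: d) = L u + t *: L d by rewrite linearD linearZ.
rewrite /sqnorm LE !(innerDr, innerDl, innerZr, innerZl).
rewrite -(sL u d) (innerC d); ring.
Qed.

Lemma quadratic_at_sqr_affine {V : euclideanType R} (C : {linear E -> V}) e u :
  quadratic_at (fun v => `|C v + e| ^+ 2) u (2 *: adj C (C u + e)).
Proof.
exists (fun d => '[C d, C d]) => t d.
rewrite -!inner_norm innerZl adjE.
have -> : C (u + t *: d) = C u + t *: C d by rewrite linearD linearZ.
rewrite !(innerDr, innerDl, innerZr, innerZl) (innerC (C d) (C u)).
rewrite (innerC (C d) e); ring.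
Qed.

Lemma quadratic_at_majorant (f : E -> R) (L : {linear E -> E}) u0 u :
  self_adjoint inner L ->
  quadratic_at (majorant f L ^~ u0) u (grad f u0 + L (u - u0)).
Proof.
move=> sL; rewrite -[grad f u0]add0r.
have -> : L (u - u0) = 2^-1 *: (2 *: L (u - u0)) by rewrite scalerA mulVf// scale1r.
apply: quadratic_atD; first apply: quadratic_atD.
- exact: quadratic_at_cst.
- by apply: quadratic_at_shift; apply: quadratic_at_inner.
- by apply: quadratic_atZ; apply: quadratic_at_shift; apply: quadratic_at_sqnorm.
Qed.

Lemma ge0_affine_near0 (a K : R) :
  (forall t, 0 < t <= 1 -> 0 <= a + t * K) -> 0 <= a.
Proof.
move=> aK; rewrite leNgt; apply/negP => a0.
have D0 : 0 < 1 + `|K| - a by rewrite subr_gt0 (lt_le_trans a0) ?addr_ge0.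
have K1 : 0 < 1 + `|K| - a - K by have := ler_norm K; lra.
(* An explicit [t] replaces the limit: for [a < 0] it is admissible, and [a + t * K] becomes [a]
   times a positive factor. *)
have t01 : 0 < - a / (1 + `|K| - a) <= 1.
  by rewrite divr_gt0 ?oppr_gt0// ler_pdivrMr// mul1r lerDr addr_ge0.
have := aK _ t01; rewrite -(pmulr_rge0 _ D0).
have -> : (1 + `|K| - a) * (a + - a / (1 + `|K| - a) * K)
    = a * (1 + `|K| - a - K) by field; rewrite gt_eqF.
by rewrite leNgt nmulr_rlt0// K1.
Qed.

Lemma minimizer_quadratic (p : E -> \bar R) h u G :
  eproper p -> econvex p -> quadratic_at h u G ->
  minimizer (fun v => p v + (h v)%:E)%E u -> subdifferential p u (- G).
Proof.
move=> [pNy [v0 pv0]] cp [K hK] umin v.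
(* If [p u] were [+oo], minimality would force [+oo] at [v0] too, where [p] is finite. *)
have pu_fin : p u \is a fin_num.
  rewrite fin_numE pNy/=; apply/negP => /eqP pu.
  have := umin v0; rewrite pu addye// leye_eq => /eqP.
  by case: (p v0) pv0 (pNy v0).
have := cp _ v u; have := umin; rewrite /minimizer -(fineK pu_fin).
case: (p v) (pNy v) => [b _|_|//]; last by rewrite leey.
set a := fine (p u) => hmin hcvx.
rewrite -EFinD lee_fin innerNl -subr_ge0.
apply: (@ge0_affine_near0 _ (K (v - u))) => t /andP[t0 t1].
have t01 : 0 <= t <= 1 by rewrite ltW.
have := le_trans (hmin _) (leeD2r _ (hcvx _ t01)).
have -> : t *: v + (1 - t) *: u = u + t *: (v - u).
  by rewrite scalerBl scale1r scalerBr addrCA.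
rewrite hK -!EFinM -!EFinD lee_fin => abt.
(* Cancelling [a + h u] in [abt] leaves exactly [t] times the goal. *)
rewrite -(pmulr_rge0 _ t0); lra.
Qed.

(** Common form of both subproblems: [C], [e] are [B], [A y - c] for the z-step and [A], [B z' - c]
    for the y-step. Keeping [sigma] inside [adj C] lets the multiplier update be substituted
    directly. *)
Lemma subproblem_optimality {V : euclideanType R} (p : E -> \bar R) (f : E -> R)
    (L P : {linear E -> E}) (C : {linear E -> V}) (e : V) b u0 u (sigma : R) :
  closed_proper_convex p -> self_adjoint inner L -> self_adjoint inner P ->
  minimizer (fun v => p v + (majorant f L v u0 + '[b, v]
    + sigma / 2 * `|C v + e| ^+ 2 + 2^-1 * sqnorm P (v - u0))%:E)%E u ->
  subdifferential p u (- (grad f u0 + L (u - u0) + b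
    + adj C (sigma *: (C u + e)) + P (u - u0))).
Proof.
move=> [_ pp cp] sL sP; apply: minimizer_quadratic => //.
have -> : adj C (sigma *: (C u + e)) = (sigma / 2) *: (2 *: adj C (C u + e)).
  by rewrite scalerA divfK// linearZ.
have -> : P (u - u0) = 2^-1 *: (2 *: P (u - u0)) by rewrite scalerA mulVf// scale1r.
apply: quadratic_atD; first apply: quadratic_atD; first apply: quadratic_atD.
- exact: quadratic_at_majorant.
- exact: quadratic_at_inner.
- by apply: quadratic_atZ; apply: quadratic_at_sqr_affine.
- by apply: quadratic_atZ; apply: quadratic_at_shift; apply: quadratic_at_sqnorm.
Qed.

End quadratic_at.

Section admm.
Context {R : realType} {Y Z X : euclideanType R}.
Variables (p : Y -> \bar R) (q : Z -> \bar R) (f : Y -> R) (g : Z -> R).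
Variables (A : {linear Y -> X}) (B : {linear Z -> X}) (c : X).
Variables (Sf S : {linear Y -> Y}) (Sg T : {linear Z -> Z}) (sigma : R).
Implicit Types w : prodH Y Z X.

(** The term [opFsm w'] inside [opR] cancels against the one subtracted in [perturbation]. *)
Lemma perturbed_ppa_nsE w w' :
  perturbed_ppa p q f g A B c Sf S Sg T sigma w w' <->
  perturbed_ppa_ns p q f g A B c Sf S Sg T sigma w w'.
Proof.
have E (u m : prodH Y Z X) :
    u + opFsm f g w' + m + perturbation f g w w' = u + opFsm f g w + m.
  by rewrite /perturbation addrAC -(addrA u) (addrC (opFsm f g w')) subrK.
split=> [[_ [u uR <-]]|[u uR]]; rewrite ?E => u0; first by exists u.
by exists (u + opFsm f g w'); [exists u|rewrite E].
Qed.

Lemma admm_step_ppa_ns w w' :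
  closed_proper_convex p -> closed_proper_convex q ->
  self_adjoint inner Sf -> self_adjoint inner Sg ->
  self_adjoint inner S -> self_adjoint inner T -> sigma != 0 ->
  admm_step p q f g A B c Sf S Sg T sigma w w' ->
  perturbed_ppa_ns p q f g A B c Sf S Sg T sigma w w'.
Proof.
case: w w' => [[y z] x] [[y' z'] x'] hp hq sSf sSg sS sT s0 [/= zmin xE ymin].
have {}zmin : minimizer (fun v => q v + (majorant g Sg v z + '[adj B x, v]
    + sigma / 2 * `|B v + (A y - c)| ^+ 2 + 2^-1 * sqnorm T (v - z))%:E)%E z'.
  by move=> v; have := zmin v; rewrite /z_objective/= ![B _ + (_ - _)]addrCA !addrA.
have {}ymin : minimizer (fun v => p v + (majorant f Sf v y + '[adj A x', v]
    + sigma / 2 * `|A v + (B z' - c)| ^+ 2 + 2^-1 * sqnorm S (v - y))%:E)%E y'.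
  by move=> v; have := ymin v; rewrite /y_objective/= !addrA.
have zopt := subproblem_optimality _ _ _ _ _ _ _ _ _ _ hq sSg sT zmin.
have yopt := subproblem_optimality _ _ _ _ _ _ _ _ _ _ hp sSf sS ymin.
have {}xE : sigma *: (A y + B z' - c) = x' - x by rewrite xE [x + _]addrC addrK.
(* The multiplier update uses the old [y], as the z-step does, so the penalty gradient just turns
   [adj B x] into [adj B x']. *)
have stepE : sigma *: (B z' + (A y - c)) = x' - x.
  by rewrite addrA (addrC (B z')).
(* The y-step penalty involves the new [y']. The correction produces the block
   [sigma *: adj A (A _)] of [opM], and [x' - x] its block [adj A]. *)
have step'E : sigma *: (A y' + (B z' - c)) = x' - x + sigma *: A (y' - y).
  rewrite -xE -scalerDr linearB; congr (_ *: _).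
  by rewrite [RHS]addrC -(addrA (A y)) [RHS]addrA subrK.
eexists; first by eexists; [exact: yopt|eexists; [exact: zopt|reflexivity]].
have pair0 (a : Y) (b : Z) (d : X) : a = 0 -> b = 0 -> d = 0 -> (a, b, d) = 0 :> prodH Y Z X.
  by move=> -> -> ->.
(* Pairing with an arbitrary [v] reduces each vector identity to a scalar one for [ring]. *)
apply: pair0 => /=; apply: inner_inj => v.
- rewrite step'E !(innerDl, innerNl, innerZl, adjE, inner0l); ring.
- rewrite stepE !(innerDl, innerNl, innerZl, adjE, inner0l); ring.
- rewrite -xE scalerA mulVf// scale1r linearB.
  rewrite !(innerDl, innerNl, inner0l); ring.
Qed.

(** The off-diagonal blocks [A] and [adj A] are exchanged when the operator moves across the inner
    product. *)
Lemma opM_self_adjoint :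
  self_adjoint inner (S \+ Sf) -> self_adjoint inner (T \+ Sg) ->
  self_adjoint (@innerH R Y Z X) (opM A Sf S Sg T sigma).
Proof.
move=> sS sT [[y z] x] [[y' z'] x']; rewrite /= /innerH/=.
have := sS y y'; have := sT z z' => /=.
rewrite !(innerDl, innerDr, innerZl, innerZr, adjE).
rewrite !(innerC _ (adj _ _)) !adjE (innerC (A y') (A y)) (innerC (A y) x').
move=> -> ->; ring.
Qed.

Lemma opM_psd : 0 < sigma -> psd inner (S \+ Sf) -> psd inner (T \+ Sg) ->
  psd (@innerH R Y Z X) (opM A Sf S Sg T sigma).
Proof.
move=> s0 [sS pS] [sT pT]; split; first exact: opM_self_adjoint.
move=> [[y z] x]; rewrite /= /innerH/=.
have -> : '[y, S y + Sf y + sigma *: adj A (A y) + adj A x] +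
    '[z, T z + Sg z] + '[x, A y + sigma^-1 *: x] =
    '[y, (S \+ Sf) y] + '[z, (T \+ Sg) z] +
    sigma * '[A y + sigma^-1 *: x, A y + sigma^-1 *: x].
  rewrite /= !(innerDl, innerDr, innerZl, innerZr).
  rewrite !(innerC _ (adj _ _)) !adjE (innerC (A y) x).
  by field; rewrite gt_eqF.
apply: addr_ge0; first by apply: addr_ge0; [exact: pS|exact: pT].
by rewrite inner_norm mulr_ge0 ?sqr_ge0// ltW.
Qed.

End admm.

Theorem proposition2p2 (R : realType) (Y Z X : euclideanType R)
    (p : Y -> \bar R) (q : Z -> \bar R) (f : Y -> R) (g : Z -> R)
    (A : {linear Y -> X}) (B : {linear Z -> X}) (c : X)
    (Sf S : {linear Y -> Y}) (Sg T : {linear Z -> Z}) (sigma : R)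
    (hp : closed_proper_convex p) (hq : closed_proper_convex q)
    (hf : convex_smooth f) (hg : convex_smooth g)
    (hSf : psd inner Sf) (hSg : psd inner Sg)
    (hfmaj : majorized f Sf) (hgmaj : majorized g Sg)
    (hS : self_adjoint inner S) (hT : self_adjoint inner T)
    (hsigma : 0 < sigma)
    (w : nat -> prodH Y Z X)
    (hw : forall k, admm_step p q f g A B c Sf S Sg T sigma (w k) (w k.+1)) :
  [/\ forall k, perturbed_ppa p q f g A B c Sf S Sg T sigma (w k) (w k.+1),
      forall u u' : prodH Y Z X,
        perturbed_ppa p q f g A B c Sf S Sg T sigma u u' <->
        perturbed_ppa_ns p q f g A B c Sf S Sg T sigma u u' &
      psd inner (S \+ Sf) -> psd inner (T \+ Sg) ->
      psd (@innerH R Y Z X) (opM A Sf S Sg T sigma)].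
Proof.
split=> [k|u u'|].
- apply/perturbed_ppa_nsE; apply: admm_step_ppa_ns (hw k) => //.
  + by case: hSf.
  + by case: hSg.
  + by rewrite gt_eqF.
- exact: perturbed_ppa_nsE.
- exact: opM_psd.
Qed.
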